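(* Let $p$ be a prime, let $d,n$ be positive integers, and let $G=V{:}H$ be a Frobenius group with Frobenius kernel $V\cong \mathrm{C}_p^d$ elementary abelian and Frobenius complement $H\cong \mathrm{C}_n$ cyclic. Let $f=\mathrm{ord}_n(p)$. Then there exist positive integers $s,\ell,e_1,\dots,e_s$ with $(e_1+\dots+e_s)f\ell=d$ and a group $L$ of order $\ell$ such that \[\mathrm{Aut}(G)=V.\Big(\big((\mathrm{GL}(e_1,p^f)^\ell\times\dots\times\mathrm{GL}(e_s,p^f)^\ell).\mathrm{C}_f\big).L\Big),\] where $\mathrm{C}_f.L\leqslant\mathrm{Aut}(H)$.
   Context: $\mathrm{C}_n$ is the cyclic group of order $n$. A Frobenius group $G=V{:}H$ is a semidirect product of a nontrivial normal subgroup $V$ (the Frobenius kernel) by a nontrivial subgroup $H$ (a Frobenius complement) such that no non-identity element of $H$ centralizes a non-identity element of $V$. Such a $G$ has trivial center, and $G$ (hence $V$) is identified with a subgroup of $\mathrm{Aut}(G)$ via inner automorphisms. $\mathrm{ord}_n(p)$ is the least positive integer $m$ such that $n$ divides $p^m-1$. For a group $T$, $T^\ell$ is the direct product of $\ell$ copies of $T$. $A.B$ denotes a group having a normal subgroup isomorphic to $A$ with quotient isomorphic to $B$ (an extension of $A$ by $B$, not necessarily split). Thus the displayed formula means: $V$ is normal in $\mathrm{Aut}(G)$, and $\mathrm{Aut}(G)/V$ has a normal subgroup $P\cong\prod_{i=1}^s\mathrm{GL}(e_i,p^f)^\ell$ whose quotient is isomorphic to a subgroup $\mathrm{C}_f.L$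 of $\mathrm{Aut}(H)$, where $\mathrm{C}_f$ is a normal subgroup of $\mathrm{C}_f.L$ with quotient $L$. Here $\mathrm{C}_f\leqslant\mathrm{Aut}(H)$ is the group of field automorphisms of $H$, i.e. the cyclic group of order $f$ generated by $h\mapsto h^p$ (induced by the Frobenius automorphism of $\mathbb{F}_{p^f}$). *)

(* Defs.v *)
From HB Require Import structures.
From mathcomp Require Import all_boot all_order all_algebra all_fingroup.
From mathcomp Require Import all_solvable all_field.

Set Implicit Arguments.
Unset Strict Implicit.
Unset Printing Implicit Defensive.

(* f = ord_n(p). The truncated subtraction is harmless: it only differs from
   the one on integers when p = 0. *)
Definition is_ord (n p f : nat) : Prop :=
  [/\ 0 < f, n %| p ^ f - 1 & forall m, 0 < m -> n %| p ^ m - 1 -> f <= m].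

(* GL(e_0, F)^l x ... x GL(e_{s-1}, F)^l. MathComp defines {'GL_m[F]} as the
   units of 'M[F]_m.-1.+1, which is the intended group only for m > 0. *)
Definition GLprod (F : finFieldType) (s l : nat) (e : 'I_s -> nat) :
    finGroupType :=
  {dffun forall i : 'I_s, {dffun forall j : 'I_l, {'GL_(e i)[F]}}}.

Local Open Scope group_scope.

(* phi is the automorphism h |-> h ^+ p of H. It is unique if it exists: members
   of Aut H are permutations of the ambient type that are trivial off H. *)
Definition is_power_aut (gT : finGroupType) (H : {group gT}) (p : nat)
    (phi : {perm gT}) : Prop :=
  phi \in Aut H /\ {in H, forall h, phi h = h ^+ p}.

(* The copy of V in Aut G given by conjugation. *)
Definition inner_image (gT : finGroupType) (G V : {group gT}) :
    {group {perm gT}} :=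
  (conj_aut G @* V)%G.

(* Main.v *)
(* V is an F_p[H]-module on which H = <x> acts fixed-point-freely, so after
   extension of scalars to F = F_(p^f) the generator x becomes diagonalizable,
   with eigenvalues primitive n-th roots of unity, on which Frobenius acts
   freely, with orbits of size f. Galois descent (the trace from F to F_p) shows
   that the centralizer of x in GL(V) is the product of the groups GL(E_lambda),
   for lambda in a set of representatives of the Frobenius orbits.
   By Schur-Zassenhaus, Aut G = V : A where A is the stabilizer of H. The kernel
   of the restriction A -> Aut H is this centralizer, and its image K permutes
   the eigenvalues freely and preserves multiplicities; hence the Frobenius
   orbits are permuted by K / C_f in regular orbits of length l = |K / C_f|, on
   each of which the multiplicity e_i is constant. *)
Require Import Defs.
From HB Require Import structures.
From mathcomp Require Import all_boot all_order all_algebra all_fingroup.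
From mathcomp Require Import all_solvable all_field all_character.

Set Implicit Arguments.
Unset Strict Implicit.
Unset Printing Implicit Defensive.

Import GRing.Theory.

Local Open Scope group_scope.

(** * Frobenius, spectral projections and Galois descent *)

Section Frobenius.

Local Open Scope ring_scope.

(** The characteristic hypothesis is an argument so that the ring morphism instances below can be
    attached to [frob pcharF k]. *)
Definition frob (p : nat) (F : fieldType) of p \in [pchar F] :=
  fun (k : nat) (x : F) => x ^+ (p ^ k).

Variables (p : nat) (F : fieldType) (pcharF : p \in [pchar F]).
Local Notation fr := (frob pcharF).

Fact frob_additive k : zmod_morphism (fr k).
Proof.
have pk : [pchar F].-nat (p ^ k)%N.
  have pr_p := pcharf_prime pcharF.
  by rewrite (eq_pnat _ (pcharf_eq pcharF)) pnatX pnat_id.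
by move=> x y; rewrite /frob exprDn_pchar // exprNn_pchar.
Qed.

Fact frob_multiplicative k : monoid_morphism (fr k).
Proof. by split=> [|x y]; rewrite /frob ?expr1n // exprMn. Qed.

HB.instance Definition _ k :=
  GRing.isZmodMorphism.Build F F (fr k) (frob_additive k).
HB.instance Definition _ k :=
  GRing.isMonoidMorphism.Build F F (fr k) (frob_multiplicative k).

Lemma frobD j k x : fr (j + k) x = fr j (fr k x).
Proof. by rewrite /frob -exprM -expnD addnC. Qed.

Lemma frob0 x : fr 0 x = x.
Proof. by rewrite /frob expr1. Qed.

Lemma map_frobD m n j k (A : 'M_(m, n)) :
  map_mx (fr (j + k)) A = map_mx (fr j) (map_mx (fr k) A).
Proof. by apply/matrixP=> a b; rewrite !mxE frobD. Qed.

Variable iota : {rmorphism 'F_p -> F}.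

Lemma frob_iota k a : fr k (iota a) = iota a.
Proof.
have pr_p := pcharf_prime pcharF.
rewrite /frob -rmorphXn; congr (iota _); elim: k => [|k IHk]; first exact: expr1.
by rewrite expnSr exprM IHk -[RHS]expf_card card_Fp.
Qed.

Lemma map_frob_iota m n k (A : 'M_(m, n)) :
  map_mx (fr k) (map_mx iota A) = map_mx iota A.
Proof. by apply/matrixP=> a b; rewrite !mxE frob_iota. Qed.

(** The fixed points are roots of ['X^p - 'X], and [iota] already supplies [p] of them, as many as
    the degree allows. *)
Lemma frob_fixed x : fr 1 x = x -> exists a, x = iota a.
Proof.
have pr_p := pcharf_prime pcharF; rewrite /frob expn1 => xp.
have szP : size ('X^p - 'X : {poly F}) = p.+1.
  by rewrite size_polyDl size_polyXn // size_polyN size_polyX ltnS prime_gt1.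
have nzP : ('X^p - 'X : {poly F}) != 0 by rewrite -size_poly_eq0 szP.
have rootI a : root ('X^p - 'X) (iota a).
  by rewrite rootE !hornerE -{2}(frob_iota 1 a) /frob expn1 subrr.
pose s := [seq iota a | a : 'F_p].
have [/imageP[a _ ->] | s'x] := boolP (x \in s); first by exists a.
have roots_s : all (root ('X^p - 'X)) (x :: s).
  rewrite /= rootE !hornerE xp subrr eqxx /=.
  by apply/allP=> _ /imageP[a _ ->].
have uniq_s : uniq (x :: s).
  by rewrite /= s'x map_inj_uniq ?enum_uniq //; apply: fmorph_inj.
have := max_poly_roots nzP roots_s uniq_s.
by rewrite szP /= size_map -cardE card_Fp // ltnn.
Qed.

Lemma map_frob_fixed m n (A : 'M_(m, n)) :
  map_mx (fr 1) A = A -> exists A0, A = map_mx iota A0.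
Proof.
move=> frA.
have /fin_all_exists[g Ag]: forall ij, exists a, A ij.1 ij.2 = iota a.
  by move=> ij; apply: frob_fixed; rewrite -{2}frA mxE.
by exists (\matrix_(i, j) g (i, j)); apply/matrixP=> i j; rewrite !mxE -Ag.
Qed.

End Frobenius.

Lemma eigenrows_exp (R : comPzRingType) q m (W : 'M[R]_(q, m)) (M : 'M[R]_m) mu k :
  (W *m M = mu *: W -> W *m M ^+ k = mu ^+ k *: W)%R.
Proof.
move=> WM; elim: k => [|k IHk]; first by rewrite mulmx1 scale1r.
by rewrite exprSr -mulmxE mulmxA IHk -scalemxAl WM scalerA -exprSr.
Qed.

(** * Spectral projections of a matrix of finite order *)

Section Spectral.

Local Open Scope ring_scope.

Variables (F : fieldType) (n d : nat) (z : F).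
Hypothesis prim_z : n.-primitive_root z.
Variable M : 'M[F]_d.
Hypothesis Mn1 : M ^+ n = 1%:M.

(** The idempotent attached to the character [t |-> mu ^+ t] of the cyclic group of order [n]: when
    [mu ^+ n = 1], it projects onto the [mu]-eigenspace of [M]. The primitive root [z] guarantees
    that [n] is invertible in [F]. *)
Definition spectral_proj (M : 'M[F]_d) (mu : F) : 'M[F]_d :=
  n%:R^-1 *: \sum_(t < n) mu ^- t *: M ^+ t.
Local Notation proj := (spectral_proj M).

Let n_gt0 : (0 < n)%N. Proof. exact: prim_order_gt0 prim_z. Qed.
Let nF : n%:R != 0 :> F. Proof. exact: prim_root_natf_neq0 prim_z. Qed.

Lemma unity_root_sum (mu : F) : mu ^+ n = 1 ->
  \sum_(t < n) mu ^+ t = (mu == 1)%:R * n%:R :> F.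
Proof.
move=> mun; case: eqP => [->|/eqP mu1].
  by rewrite (eq_bigr (fun=> 1)) ?mul1r => [|i _]; rewrite ?sumr_const ?card_ord ?expr1n.
have: (1 - mu ^+ n) = 0 by rewrite mun subrr.
rewrite -{1}(expr1n F n) subrXX => /eqP.
rewrite mulf_eq0 subr_eq0 eq_sym (negPf mu1) /= mul0r => /eqP sum0.
by rewrite -[RHS]sum0; apply: eq_bigr => i _; rewrite expr1n mul1r.
Qed.

Lemma mulmx_spectral_proj m (B : 'M_(m, d)) lam mu :
    lam ^+ n = 1 -> mu ^+ n = 1 -> B *m M = lam *: B ->
  B *m proj mu = (lam == mu)%:R *: B.
Proof.
move=> lamn mun BM.
have mu0: mu != 0 by apply: contra_eq_neq mun => ->; rewrite expr0n gtn_eqF // eq_sym oner_eq0.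
rewrite -scalemxAr mulmx_sumr.
under eq_bigr => t _ do rewrite -scalemxAr (eigenrows_exp t BM) scalerA -exprVn -exprMn.
rewrite -scaler_suml unity_root_sum; last by rewrite exprMn exprVn lamn mun invr1 mulr1.
rewrite scalerA mulrCA mulVf // mulr1; congr (_%:R *: _).
by rewrite (can2_eq (mulVKf mu0) (mulKf mu0)) mulr1.
Qed.

(** Multiplication by [M] shifts the summation index cyclically. *)
Lemma spectral_projM mu : mu ^+ n = 1 -> proj mu *m M = mu *: proj mu.
Proof.
move=> mun.
have mu0: mu != 0 by apply: contra_eq_neq mun => ->; rewrite expr0n gtn_eqF // eq_sym oner_eq0.
rewrite /spectral_proj -scalemxAl scalerA mulrC -scalerA; congr (_ *: _).
rewrite mulmx_suml scaler_sumr -(prednK n_gt0).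
(* The last term on the left matches the term [t = 0] on the right, because [M ^+ n = 1]. *)
rewrite big_ord_recr big_ord_recl /= addrC; congr (_ + _).
  rewrite -scalemxAl mulmxE -exprSr prednK // Mn1 expr0 invr1 scale1r.
  congr (_ *: _); apply: (mulIf (expf_neq0 n.-1 mu0)).
  by rewrite mulVf ?expf_neq0 // -exprS prednK.
apply: eq_bigr => i _; rewrite -scalemxAl mulmxE -exprSr scalerA.
by congr (_ *: _); rewrite exprS invfM mulrA mulfV ?mul1r.
Qed.

(** After exchanging the sums, orthogonality of characters leaves only the term [t = 0]. *)
Lemma spectral_proj_sum : \sum_(a < n) proj (z ^+ a) = 1%:M.
Proof.
rewrite -scaler_sumr exchange_big /=.
under eq_bigr => t _.
  rewrite -scaler_suml.
  rewrite (eq_bigr (fun a : 'I_n => (z ^- t) ^+ a)); last first.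
    by move=> a _; rewrite exprVn -!exprM mulnC.
  rewrite unity_root_sum; last first.
    by rewrite exprVn -exprM mulnC exprM (prim_expr_order prim_z) expr1n invr1.
  over.
rewrite (bigD1 (Ordinal n_gt0)) //= big1 => [|t].
  by rewrite expr0 invr1 eqxx mul1r addr0 scalerA mulVf // scale1r.
rewrite -val_eqE /= => tn0.
rewrite invr_eq1 -(prim_order_dvd prim_z) gtnNdvd ?lt0n ?mul0r ?scale0r //.
Qed.

End Spectral.

(** * Galois descent from [F] to the prime field *)

Section Descent.

Local Open Scope ring_scope.

Variables (p f n d : nat) (F : finFieldType) (pcharF : p \in [pchar F]).
Variables (iota : {rmorphism 'F_p -> F}) (z : F) (M : 'M['F_p]_d).
Hypotheses (cardF : #|F| = (p ^ f)%N) (prim_z : n.-primitive_root z).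
Hypothesis Mn1 : M ^+ n = 1%:M.
Variables (J : finType) (lam : J -> F) (r : J -> nat).
Variable B : forall j, 'M[F]_(r j, d).
Local Notation fr := (frob pcharF).
Local Notation MF := (map_mx iota M).
Local Notation "A ^i" := (map_mx iota A) (at level 2).
Hypothesis lam_n : forall j, lam j ^+ n = 1.
Hypothesis freeB : forall j, row_free (B j).
Hypothesis eqB : forall j, (B j == eigenspace MF (lam j))%MS.
(** The [lam j] lie in distinct Frobenius orbits of full length [f]; by [lam_onto] these orbits
    exhaust the eigenvalues of [MF]. *)
Hypothesis lam_inj :
  forall j j' k, (k < f)%N -> fr k (lam j) = lam j' -> (k = 0)%N /\ j = j'.
Hypothesis lam_onto : forall mu, mu ^+ n = 1 -> eigenvalue MF mu ->
  exists j k, mu = fr k (lam j).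

Let MFn1 : MF ^+ n = 1%:M.
Proof. by rewrite -rmorphXn /= Mn1 map_mx1. Qed.

Let f_gt0 : (0 < f)%N.
Proof. by case: f cardF (card_finNzRing_gt1 F) => // ->. Qed.

Lemma frob_period x : fr f x = x.
Proof. by rewrite /frob -cardF expf_card. Qed.

Lemma map_spectral_proj k mu :
  map_mx (fr k) (spectral_proj n MF mu) = spectral_proj n MF (fr k mu).
Proof.
rewrite map_mxZ fmorphV rmorph_nat; congr (_ *: _).
rewrite raddf_sum; apply: eq_bigr => t _ /=.
by rewrite map_mxZ fmorphV !rmorphXn /= map_frob_iota.
Qed.

Lemma eigenrowsM j k : map_mx (fr k) (B j) *m MF = fr k (lam j) *: map_mx (fr k) (B j).
Proof.
have /andP[/eigenspaceP BM _] := eqB j.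
by rewrite -{1}(map_frob_iota pcharF iota k M) -map_mxM BM map_mxZ.
Qed.

Let eigenrows0M j : B j *m MF = lam j *: B j.
Proof. by have /andP[/eigenspaceP] := eqB j. Qed.

(* The solution over F is a trace, hence defined over F_p; the terms with k > 0
   are annihilated by B j because fr k (lam j') is an eigenvalue distinct from
   lam j. *)
Theorem descent_ex m (C : forall j, 'M[F]_(r j, m)) :
  exists X : 'M['F_p]_(d, m), forall j, B j *m X^i = C j.
Proof.
(* [Y] solves the system over [F]: [pinvmx (B j)] is a right inverse of the row-free matrix
   [B j]. *)
pose Y := \sum_j spectral_proj n MF (lam j) *m pinvmx (B j) *m C j.
pose X := \sum_(k < f) map_mx (fr k) Y.
have /(map_frob_fixed iota)[X0 defX0]: map_mx (fr 1) X = X.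
  (* Frobenius permutes the terms of the trace cyclically: the term [f - 1] returns to the term [0]
     by [frob_period]. *)
  rewrite /X raddf_sum /=; case: f frob_period => [|f'] frK; first by rewrite !big_ord0.
  rewrite [LHS]big_ord_recr [RHS]big_ord_recl /= addrC; congr (_ + _).
    by rewrite -map_frobD; apply/matrixP=> a b; rewrite !mxE frK frob0.
  by apply: eq_bigr => k _; rewrite -map_frobD.
exists X0 => j; rewrite -defX0 /X mulmx_sumr.
have frn k i : fr k (lam i) ^+ n = 1 by rewrite -rmorphXn lam_n rmorph1.
have BY k : B j *m map_mx (fr k) Y
    = \sum_i (lam j == fr k (lam i))%:R *: (B j *m map_mx (fr k) (pinvmx (B i) *m C i)).
  rewrite raddf_sum /= mulmx_sumr; apply: eq_bigr => i _.
  rewrite -mulmxA map_mxM mulmxA map_spectral_proj.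
  by rewrite (mulmx_spectral_proj prim_z _ _ (eigenrows0M j)) // -scalemxAl.
have sum0 (k : 'I_f) i : ~ ((k = 0 :> nat)%N /\ i = j) -> (lam j == fr k (lam i)) = false.
  by move=> neq; apply/eqP=> /esym/(lam_inj (ltn_ord k)).
rewrite (bigD1 (Ordinal f_gt0)) //= big1 => [|k k0]; rewrite BY.
  rewrite (bigD1 j) //= big1 => [|i ij].
    rewrite frob0 eqxx scale1r !addr0 map_mx_id; last exact: frob0.
    by rewrite mulmxA mulmxVp ?mul1mx.
  by rewrite (sum0 (Ordinal f_gt0)) ?scale0r // => -[_ /eqP]; apply/negP.
by rewrite big1 // => i _; rewrite sum0 ?scale0r // => -[/eqP k_0 _]; case/negP: k0.
Qed.

(** The spectral projections sum to 1, so it suffices that [X - X'] vanishes on each eigenspace.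
    Every eigenspace is a Frobenius conjugate of some [B j], and [X - X'] is fixed by Frobenius. *)
Theorem descent_uniq m (X X' : 'M['F_p]_(d, m)) :
  (forall j, B j *m X^i = B j *m X'^i) -> X = X'.
Proof.
move=> eqXX'; apply: (map_mx_inj (f := iota)).
apply/eqP; rewrite -subr_eq0 -[X^i - _]mul1mx -(spectral_proj_sum prim_z MF) mulmx_suml.
apply/eqP; apply: big1 => a _; set mu := z ^+ a.
have mun : mu ^+ n = 1 by rewrite -exprM mulnC exprM (prim_expr_order prim_z) expr1n.
have sE : (spectral_proj n MF mu <= eigenspace MF mu)%MS.
  by apply/eigenspaceP; apply: (spectral_projM prim_z MFn1 mun).
have [/(lam_onto mun)[j [k def_mu]] | ] := boolP (eigenvalue MF mu); last first.
  by rewrite negbK => /eqP E0; move: sE; rewrite E0 submx0 => /eqP->; rewrite mul0mx.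
have: (spectral_proj n MF mu <= map_mx (fr k) (B j))%MS.
  apply: submx_trans sE _; rewrite def_mu -{1}(map_frob_iota pcharF iota k M).
  by rewrite -map_eigenspace map_submx; have /andP[] := eqB j.
case/submxP=> D ->.
rewrite -mulmxA mulmxBr -(map_frob_iota pcharF iota k X) -(map_frob_iota pcharF iota k X').
by rewrite -!map_mxM eqXX' subrr mulmx0.
Qed.

(* Both sides count the column vectors in F_p^d, identified by descent with
   families of column vectors over F. *)
Lemma descent_card : d = (f * \sum_j r j)%N.
Proof.
pose T := {dffun forall j, 'cV[F]_(r j)}.
pose g (X : 'cV['F_p]_d) : T := [ffun j => B j *m X^i].
have g_inj : injective g.
  by move=> X X' /ffunP eqg; apply: descent_uniq => j; have:= eqg j; rewrite !ffunE.
have g_onto : forall Y, exists X, g X = Y.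
  by move=> Y; have [X XY] := descent_ex Y; exists X; apply/ffunP=> j; rewrite ffunE.
have [h hK] := fin_all_exists g_onto.
have: #|{: 'cV['F_p]_d}| = #|{: T}|.
  by apply: bij_eq_card (Bijective _ hK) => X; apply: g_inj.
have pr_p := pcharf_prime pcharF.
rewrite card_mx muln1 card_Fp // card_dep_ffun.
rewrite foldrE big_image /=.
under eq_bigr => j _ do rewrite card_mx muln1 cardF -expnM.
rewrite -expn_sum -big_distrr /=.
by apply/expnI/prime_gt1.
Qed.

End Descent.

(** * Automorphisms of a Frobenius group *)

(** The quotient map by [U] restricts to an isomorphism from the complement [A] onto [G / U] that
    carries [C] to [C / U]. It is applied below to the complement of [V] in [Aut G]. *)
Lemma quotient_compl (gT : finGroupType) (G U A C : {group gT}) :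
    U <| G -> U * A = G -> U :&: A = 1 -> C <| A ->
  [/\ C / U <| G / U, C \isog C / U & (G / U) / (C / U) \isog A / C].
Proof.
move=> nsUG defG tiUA nsCA; have [sCA nCA] := andP nsCA.
have sAG : A \subset G by rewrite -defG mulG_subr.
have nUA : A \subset 'N(U) := subset_trans sAG (normal_norm nsUG).
have defGU : G / U = A / U by rewrite -defG quotientMidl.
have /isomP[inj_f im_f] := quotient_isom nUA tiUA.
split; first by rewrite defGU quotient_normal.
  by apply: quotient_isog (subset_trans sCA nUA) _; apply/trivgP; rewrite -tiUA setIS.
set f := restrm_morphism _ _ in inj_f im_f.
have im_C : f @* C = C / U by rewrite morphim_restrm (setIidPr sCA).
rewrite defGU -[X in (X / _) \isog _]im_f -im_C -(morphim_quotm f nsCA).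
by rewrite isog_sym sub_isog ?injm_quotm.
Qed.

Section AutFrobenius.

Variables (gT : finGroupType) (G V H : {group gT}).
Hypothesis frobG : [Frobenius G = V ><| H].
Local Notation E := (inner_image G V).

Let defG : V ><| H = G. Proof. by have [] := Frobenius_context frobG. Qed.
Let sVG : V \subset G. Proof. by have [/andP[]] := sdprod_context defG. Qed.
Let nsVG : V <| G. Proof. by have [] := sdprod_context defG. Qed.
Let sHG : H \subset G. Proof. by have [] := sdprod_context defG. Qed.

(** [V] is a normal Hall subgroup, hence equal to a [pi]-core. *)
Lemma Frobenius_ker_char : V \char G.
Proof.
have hallV := Hall_pi (Frobenius_ker_Hall frobG).
by rewrite -(normal_Hall_pcore hallV nsVG) pcore_char.
Qed.

Lemma Aut_Frobenius_ker a v : a \in Aut G -> v \in V -> a v \in V.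
Proof.
move=> AutGa Vv; have [_ /forall_inP chV] := andP Frobenius_ker_char.
by apply: (subsetP (chV a AutGa)); apply: imset_f.
Qed.

Lemma conj_aut_conjg a g : a \in Aut G -> g \in G ->
  conj_aut G g ^ a = conj_aut G (a g).
Proof.
move=> AutGa Gg; have Gag : a g \in G by rewrite Aut_closed.
have AutGi : conj_aut G g \in Aut G by apply: Aut_aut.
apply: (eq_Aut (A := G)); rewrite ?Aut_aut ?groupJ // => y Gy.
have Gy' : (a^-1 y) \in G by rewrite Aut_closed ?groupV.
rewrite (conj_autE Gag Gy) conjgE !permM (conj_autE Gg Gy') -(autmE AutGa) morphJ //=.
by rewrite !autmE permKV.
Qed.

(** An element of [V] inducing the trivial automorphism centralizes [H], and ['C_V(H)] is
    trivial. *)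
Lemma injm_conj_aut_ker : {in V &, injective (conj_aut G)}.
Proof.
have cent1 w : w \in V -> conj_aut G w = 1 -> w = 1.
  move=> Vw w1; apply/set1gP; rewrite -(Frobenius_trivg_cent frobG) inE Vw.
  apply/centP=> h Hh; have Gh := subsetP sHG h Hh.
  have Gw := subsetP sVG w Vw.
  have: h ^ w = h by rewrite -(conj_autE Gw Gh) w1 perm1.
  by move/conjg_fixP/commgP.
have sVN : {subset V <= 'N(G)} by move=> v /(subsetP sVG)/(subsetP (normG G)).
move=> v w Vv Vw eq_vw; apply/eqP; rewrite eq_mulgV1; apply/eqP/cent1.
  by rewrite groupM ?groupV.
by rewrite conj_aut_morphM ?groupV ?sVN // eq_vw -conj_aut_morphM ?groupV ?sVN // mulgV morph1.
Qed.

Lemma inner_image_normal : E <| Aut G.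
Proof.
rewrite /normal Aut_conj_aut; apply/subsetP=> a AutGa; rewrite inE.
apply/subsetP=> _ /imsetP[_ /morphimP[v _ Vv ->] ->].
rewrite conj_aut_conjg ?(subsetP sVG) //; apply: mem_morphim.
  by rewrite (subsetP (normG G)) // Aut_closed // (subsetP sVG).
exact: Aut_Frobenius_ker.
Qed.

Lemma inner_imageP a : reflect (exists2 v, v \in V & a = conj_aut G v) (a \in E).
Proof.
apply: (iffP morphimP) => [[v _ Vv ->] | [v Vv ->]]; exists v => //.
by rewrite (subsetP (normG G)) // (subsetP sVG).
Qed.

Lemma inner_image_isog : V \isog E.
Proof.
have sVN := subset_trans sVG (normG G).
have injV : 'injm (restrm sVN (conj_aut G)).
  by apply/injmP=> v w; apply: injm_conj_aut_ker.
apply/isogP; exists (restrm_morphism sVN (conj_aut_morphism G)) => //=.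
by rewrite morphim_restrm setIid.
Qed.

Lemma astabs_permP (S : {set gT}) (a : {perm gT}) :
  reflect {in S, forall h, a h \in S} (a \in 'N(S | 'P)).
Proof.
rewrite !inE /=; apply: (iffP subsetP) => Sa h Sh; first by have:= Sa h Sh; rewrite inE.
by rewrite inE; apply: Sa.
Qed.

(** If [v] in [V] normalizes [H], then [[~ v, h]] lies in [V :&: H = 1], so [v] centralizes [H] and
    is trivial. *)
Lemma inner_image_TI : E :&: (Aut G :&: 'N(H | 'P)) = 1.
Proof.
apply/trivgP/subsetP=> a /setIP[/inner_imageP[v Vv ->] /setIP[_]].
move/astabs_permP=> vH; apply/set1gP.
suffices -> : v = 1 by rewrite morph1.
have Gv := subsetP sVG v Vv.
have nHv h : h \in H -> h ^ v \in H.
  by move=> Hh; rewrite -(conj_autE Gv (subsetP sHG h Hh)) vH.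
apply/set1gP; rewrite -(Frobenius_trivg_cent frobG) inE Vv; apply/centP=> h Hh.
have [_ _ nVH tiVH] := sdprodP defG.
apply/commgP/eqP/set1gP; rewrite -tiVH inE.
apply/andP; split.
  by rewrite commgEl groupM ?groupV ?memJ_norm ?(subsetP nVH).
by rewrite commgEr groupM // nHv ?groupV.
Qed.

(** Frattini argument: the image of [H] under [a] is again a complement of [V], so by
    Schur-Zassenhaus it is a [V]-conjugate of [H], and an inner correction moves [a] into the
    stabilizer of [H]. *)
Lemma inner_image_mul : solvable V -> E * (Aut G :&: 'N(H | 'P)) = Aut G.
Proof.
move=> solV; apply/eqP; rewrite eqEsubset; apply/andP; split.
  by rewrite mul_subG ?subsetIl // Aut_conj_aut.
have [_ _ nVH tiVH] := sdprodP defG.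
apply/subsetP=> a AutGa.
pose Ha := (autm AutGa @* H)%G.
have sHaVH : Ha \subset V * H.
  by rewrite (sdprodW defG) -(im_autm AutGa) morphimS.
have card_Ha : #|Ha| = #|H| by rewrite card_injm ?injm_autm.
have [v Vv defHv] :=
  SchurZassenhaus_trans_sol solV nVH sHaVH (Frobenius_coprime frobG) card_Ha.
have Gv := subsetP sVG v Vv.
have AutGv : conj_aut G v \in Aut G by apply: Aut_aut.
have nE : conj_aut G v^-1 \in E by apply/inner_imageP; exists v^-1; rewrite ?groupV.
rewrite -(normC (subset_trans (subsetIl _ _) (normal_norm inner_image_normal))).
apply/mulsgP; exists (a * conj_aut G v^-1) (conj_aut G v) => //; last 2 first.
- by apply/inner_imageP; exists v.
- have nG g : g \in G -> g \in 'N(G) by apply: (subsetP (normG G)).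
  by rewrite -mulgA -conj_aut_morphM ?groupV ?nG // mulVg morph1 mulg1.
rewrite inE groupM ?Aut_aut //=; apply/astabs_permP=> h Hh.
have Gh := subsetP sHG h Hh.
have Gah : a h \in G by rewrite Aut_closed.
rewrite permM (conj_autE (groupVr Gv) Gah).
by rewrite -mem_conjg -defHv -(autmE AutGa) mem_morphim.
Qed.

End AutFrobenius.

Lemma Aut_sdprod (gT : finGroupType) (G V H : {group gT}) (b c : {perm gT}) :
    V ><| H = G -> b \in Aut V -> c \in Aut H ->
    {in V & H, forall v h, b (v ^ h) = b v ^ c h} ->
  exists2 a, a \in Aut G & {in V, a =1 b} /\ {in H, a =1 c}.
Proof.
move=> defG AutVb AutHc bJc.
have actbc : {in V & H, morph_act 'J 'J (autm AutVb) (autm AutHc)}.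
  by move=> v h Vv Hh /=; rewrite !autmE bJc.
have [_ _ _ tiVH] := sdprodP defG.
have injf : 'injm (sdprodm defG actbc).
  by rewrite injm_sdprodm !injm_autm !im_autm tiVH eqxx.
have imf : sdprodm defG actbc @* G = G.
  by rewrite im_sdprodm !im_autm (sdprodW defG).
have [/andP[sVG _] sHG _ _ _] := sdprod_context defG.
exists (aut injf imf); first exact: Aut_aut.
split=> [v Vv | h Hh].
  by rewrite autE ?(subsetP sVG) //= sdprodmEl //= autmE.
by rewrite autE ?(subsetP sHG) //= sdprodmEr //= autmE.
Qed.

(** * The action of [Aut G] on [V] as a representation over the prime field *)

Section AutRepr.

Variables (p : nat) (gT : finGroupType) (G V H : {group gT}).
Hypothesis frobG : [Frobenius G = V ><| H].
Local Notation E := (inner_image G V).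
Hypothesis abelE : p.-abelem E.
Hypothesis ntE : E :!=: 1.

Let nsEA := inner_image_normal frobG.
Let defG : V ><| H = G. Proof. by have [] := Frobenius_context frobG. Qed.
Let sVG : V \subset G. Proof. by have [/andP[]] := sdprod_context defG. Qed.
Let sHG : H \subset G. Proof. by have [] := sdprod_context defG. Qed.

(* V is replaced by its isomorphic copy E in Aut G, so that the action of Aut G
   becomes a conjugation and abelem_repr applies. *)
Definition Aut_repr : mx_representation 'F_p (Aut G) _ :=
  abelem_repr abelE ntE (normal_norm nsEA).
Local Notation rA := Aut_repr.
Local Notation ErV := (abelem_rV abelE ntE).
Local Notation rV_E := (rVabelem abelE ntE).
Local Notation cG := (conj_aut G).

Let cE v : v \in V -> cG v \in E.
Proof. by move=> Vv; apply/(inner_imageP frobG); exists v. Qed.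

Let cA g : cG g \in Aut G. Proof. by apply: Aut_aut. Qed.

Let cM : {in G &, {morph cG : g h / g * h}}.
Proof. by move=> g h Gg Gh; rewrite conj_aut_morphM ?(subsetP (normG G)). Qed.

Let cJ : {in G &, {morph cG : g h / g ^ h}}.
Proof.
by move=> g h Gg Gh; rewrite [RHS]conj_aut_conjg // (conj_autE Gh Gg).
Qed.

Let ErVJ : {in V & G, forall v h, ErV (cG (v ^ h)) = (ErV (cG v) *m rA (cG h))%R}.
Proof.
move=> v h Vv Gh; rewrite cJ //; last exact: (subsetP sVG).
by apply: abelem_rV_J; rewrite ?cE ?cA.
Qed.

Let rVJ u a : a \in Aut G -> rV_E (u *m rA a)%R = rV_E u ^ a.
Proof. by move=> Aa; apply: rVabelemJ. Qed.

(** The matrix [X] is transported to an automorphism [b] of [V]; the intertwining relation is the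
    compatibility that [Aut_sdprod] needs to glue [b] and [c]. *)
Lemma Aut_of_mx (X : 'M['F_p]_('dim E)) (c : {perm gT}) :
    X \in unitmx -> c \in Aut H ->
    {in H, forall h, rA (cG h) *m X = X *m rA (cG (c h))}%R ->
  exists a, [/\ a \in Aut G, rA a = X & {in H, a =1 c}].
Proof.
move=> uX AutHc XJ.
(* [b] is [X] read through the coordinates [ErV] on [E]; its values outside [V] are arbitrary. *)
have /fin_all_exists[b bP] v : exists w, v \in V ->
    w \in V /\ cG w = rV_E (ErV (cG v) *m X).
  have /(inner_imageP frobG)[w Vw defw] : rV_E (ErV (cG v) *m X) \in E by apply: mem_rVabelem.
  by exists w.
have bV v : v \in V -> b v \in V by move=> /bP[].
have cb v : v \in V -> cG (b v) = rV_E (ErV (cG v) *m X) by move=> /bP[].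
have GV v : v \in V -> v \in G by apply: (subsetP sVG).
have GH h : h \in H -> h \in G by apply: (subsetP sHG).
have cI := injm_conj_aut_ker frobG.
have bM : {in V &, {morph b : v w / v * w}}.
  move=> v w Vv Vw; apply: cI; rewrite ?groupM ?bV ?groupM //.
  rewrite cb ?groupM // !cM ?GV ?bV // abelem_rV_M ?cE // mulmxDl rVabelemD.
  by rewrite !cb.
have injb : 'injm (Morphism bM).
  apply/injmP=> v w Vv Vw /(congr1 cG); rewrite [LHS](cb v Vv) [RHS](cb w Vw).
  move/(@rVabelem_inj _ _ _ abelE ntE)/(can_inj (mulmxK uX)).
  by move/(abelem_rV_inj (cE Vv) (cE Vw))/(cI v w Vv Vw).
have imb : Morphism bM @* V = V.
  apply/eqP; rewrite eqEcard card_injm // leqnn andbT.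
  by apply/subsetP=> _ /morphimP[v _ Vv ->]; apply: bV.
have bJ : {in V & H, forall v h, aut injb imb (v ^ h) = aut injb imb v ^ c h}.
  have [_ _ nVH _] := sdprodP defG.
  have VJ v h : v \in V -> h \in H -> v ^ h \in V.
    by move=> Vv Hh; rewrite memJ_norm ?(subsetP nVH).
  move=> v h Vv Hh; have Hch : c h \in H by rewrite Aut_closed.
  rewrite !autE ?VJ //=; apply: cI; rewrite ?bV ?VJ ?bV //.
  rewrite cb ?VJ // ErVJ ?GH // (cJ (GV _ (bV v Vv)) (GH _ Hch)).
  by rewrite -mulmxA XJ // mulmxA rVJ ?cA // cb.
have [a AutGa [ab ac]] := Aut_sdprod defG (Aut_aut injb imb) AutHc bJ.
exists a; split=> //; apply/row_matrixP=> i; apply: (@rVabelem_inj _ _ _ abelE ntE).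
rewrite !rowE; move: (delta_mx _ _) => u; rewrite rVJ //.
have /(inner_imageP frobG)[v Vv def_v] : rV_E u \in E by apply: mem_rVabelem.
rewrite def_v (conj_aut_conjg AutGa (GV v Vv)) (ab v Vv) (autE injb imb Vv).
by rewrite [LHS](cb v Vv) -def_v rVabelemK.
Qed.

Lemma Aut_repr_inj a b :
    a \in Aut G -> b \in Aut G -> rA a = rA b -> {in H, a =1 b} -> a = b.
Proof.
move=> Aa Ab eq_r eqH; apply: (eq_Aut Aa Ab) => g.
rewrite -(sdprodW defG) => /mulsgP[v h Vv Hh ->{g}].
have [Gv Gh] := (subsetP sVG v Vv, subsetP sHG h Hh).
have av : a v = b v.
  apply: (injm_conj_aut_ker frobG); rewrite ?(Aut_Frobenius_ker frobG) //.
  rewrite -(conj_aut_conjg Aa Gv) -(conj_aut_conjg Ab Gv).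
  have [u ->] : exists u, cG v = rV_E u.
    by exists (ErV (cG v)); rewrite (abelem_rV_K abelE ntE (cE Vv)).
  by rewrite -(rVJ u Aa) -(rVJ u Ab) eq_r.
have autM c : c \in Aut G -> c (v * h) = c v * c h.
  by move=> Ac; apply: (morphM (autm_morphism Ac)).
by rewrite !autM // av eqH.
Qed.

Lemma Aut_reprJ a h : a \in Aut G -> h \in G ->
  (rA (cG h) *m rA a = rA a *m rA (cG (a h)))%R.
Proof.
by move=> Aa Gh; rewrite -!repr_mxM ?cA // -conj_aut_conjg // conjgC.
Qed.

(** The Frobenius condition in matrix form: [u] stands for a nontrivial element of [V] commuting
    with [h]. *)
Lemma Aut_repr_fixed h (u : 'rV_('dim E)) :
  h \in H -> (u *m rA (cG h) = u)%R -> u != 0%R -> h = 1.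
Proof.
move=> Hh uh /negP u0; apply/set1gP; apply: contra_notT u0 => nth.
have Gh := subsetP sHG h Hh.
have /(inner_imageP frobG)[v Vv def_v] : rV_E u \in E by apply: mem_rVabelem.
have: rV_E (u *m rA (cG h)) = rV_E u by rewrite uh.
rewrite rVJ ?cA // def_v -(cJ (subsetP sVG v Vv) Gh).
have [_ _ nVH _] := sdprodP defG.
have VJ : v ^ h \in V by rewrite memJ_norm ?(subsetP nVH).
move/(injm_conj_aut_ker frobG VJ Vv)/conjg_fixP/commgP => cvh.
have H1h : h \in H^# by rewrite !inE -in_set1 nth.
have: v \in 'C_V[h] by rewrite inE Vv; apply/cent1P.
rewrite (Frobenius_reg_ker frobG H1h) => /set1P v1.
by rewrite -(inj_eq (@rVabelem_inj _ _ _ abelE ntE)) rVabelem0 def_v v1 morph1.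
Qed.

End AutRepr.

(** * Multiplicities of eigenvalues *)

(** [t] runs over representatives of the [K]-orbits on [L], and [k] over representatives of the
    cosets of [<[phi]>] in [K]. Freeness makes the resulting expression of a point of [L] unique. *)
Lemma free_orbit_transversal (gT : finGroupType) (K : {group {perm gT}})
    (phi : {perm gT}) (L : {set gT}) :
    phi \in K -> {in K & L, forall (c : {perm gT}) y, c y \in L} ->
    {in K & L, forall (c : {perm gT}) y, c y = y -> c = 1} ->
  exists (s : nat) (t : 'I_s -> gT) (k : 'I_#|K : <[phi]>| -> {perm gT}),
    [/\ forall i, t i \in L, forall j, k j \in K,
        {in L, forall y, exists i j m, y = (phi ^+ m) (k j (t i))}
      & forall i j i' j' m, m < #[phi] ->
          (phi ^+ m) (k j (t i)) = k j' (t i') -> [/\ m = 0%N, i = i' & j = j']].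
Proof.
move=> Kphi actK freeK.
have actP : [acts K, on L | 'P].
  apply/subsetP=> c Kc; rewrite !inE /=; apply/subsetP=> y Ly.
  by rewrite inE; apply: actK.
have [_ sTL injT surjT] := orbit_transversalP actP.
set T := orbit_transversal _ _ _ in sTL injT surjT.
(* Products of permutations act from left to right, so [k j * phi ^+ m] applies [k j] first; hence
   left cosets [c *: <[phi]>] are the ones needed. *)
pose k (j : 'I_#|K : <[phi]>|) : {perm gT} :=
  repr (enum_val (cast_ord (esym (card_lcosets K <[phi]>)) j)).
have sphiK : <[phi]> \subset K by rewrite cycle_subG.
have kP j : exists2 c, c \in K &
    enum_val (cast_ord (esym (card_lcosets K <[phi]>)) j) = c *: <[phi]>.
  by have /lcosetsP := enum_valP (cast_ord (esym (card_lcosets K <[phi]>)) j).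
have kj j : enum_val (cast_ord (esym (card_lcosets K <[phi]>)) j) = k j *: <[phi]>.
  have [c Kc def_c] := kP j; rewrite /k def_c.
  by apply/esym/lcoset_eqP/(mem_repr c); rewrite lcoset_refl.
have Kk j : k j \in K.
  have [c Kc def_c] := kP j.
  have : k j \in c *: <[phi]> by rewrite -def_c kj lcoset_refl.
  by case/lcosetP=> u /(subsetP sphiK) Ku ->; rewrite groupM.
exists #|T|, (fun i => enum_val i), k; split=> //.
- by move=> i; apply: (subsetP sTL); apply: enum_valP.
- move=> y Ly; have [c Kc Tcy] := surjT y Ly.
  have: c^-1 *: <[phi]> \in lcosets <[phi]> K by apply/lcosetsP; exists c^-1; rewrite ?groupV.
  move=> inC; pose j := cast_ord (card_lcosets K <[phi]>) (enum_rank_in inC (c^-1 *: <[phi]>)).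
  have defC : k j *: <[phi]> = c^-1 *: <[phi]>.
    by rewrite -kj /j cast_ordK enum_rankK_in.
  have : c^-1 \in k j *: <[phi]> by rewrite defC lcoset_refl.
  case/lcosetP=> u /cycleP[m ->] def_c.
  exists (enum_rank_in Tcy (c y)), j, m.
  by rewrite enum_rankK_in // -!permM -def_c permM permK.
move=> i j i' j' m ltm eq_ij.
have Lt (i0 : 'I_#|T|) : enum_val i0 \in L by apply: (subsetP sTL); apply: enum_valP.
set t := enum_val i in eq_ij; set t' := enum_val i' in eq_ij.
have Kphim : phi ^+ m \in K by rewrite groupX.
have def_t' : t' = (k j * phi ^+ m * (k j')^-1) t by rewrite !permM eq_ij permK.
have eq_t : t = t'.
  apply/eqP; rewrite -injT ?enum_valP //; apply/orbitP.
  by exists (k j * phi ^+ m * (k j')^-1); rewrite ?groupM ?groupV.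
have /eqP: k j * phi ^+ m * (k j')^-1 = 1.
  by apply: (freeK _ t); rewrite ?groupM ?groupV ?Lt // -def_t'.
rewrite -eq_mulgV1 => /eqP eq_k.
have ii' : i = i' by apply: enum_val_inj.
have jj' : j = j'.
  apply: (can_inj (cast_ordK (esym (card_lcosets K <[phi]>)))).
  apply: enum_val_inj; rewrite !kj -eq_k; apply: lcoset_eqP.
  by rewrite mem_lcoset invMg -mulgA mulVg mulg1 groupV mem_cycle.
split=> //; move: eq_k; rewrite jj' => /(canRL (mulKg _)); rewrite mulVg => /eqP.
rewrite -order_dvdn => dvd_m; apply/eqP; rewrite -leqn0 leqNgt.
by apply: contraL ltm => m_gt0; rewrite -leqNgt dvdn_leq.
Qed.

Section CyclicChar.

Local Open Scope ring_scope.

Variables (F : fieldType) (gT : finGroupType) (x : gT) (z : F).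
Hypothesis prim_z : #[x]%g.-primitive_root z.

(** The discrete logarithm to base [x], with default value 0 outside [<[x]>]. *)
Definition cycle_log (y : gT) : nat :=
  odflt 0%N (omap val [pick i : 'I_#[x]%g | (x ^+ i)%g == y]).

(* The linear character of <[x]> mapping x to z; the eigenvalues of x are indexed
   by elements of <[x]>, on which Aut <[x]> acts naturally. *)
Definition cycle_char y : F := z ^+ cycle_log y.

Lemma cycle_logK y : y \in <[x]>%g -> (x ^+ cycle_log y)%g = y.
Proof.
move=> /cyclePmin[i ltix ->]; rewrite /cycle_log; case: pickP => [j /eqP //|].
by move=> /(_ (Ordinal ltix)); rewrite /= eqxx.
Qed.

Lemma cycle_char_gen m : cycle_char (x ^+ m)%g = z ^+ m.
Proof.
apply/eqP; rewrite (eq_prim_root_expr prim_z) -eq_expg_mod_order.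
by rewrite cycle_logK ?mem_cycle.
Qed.

Lemma cycle_charX y m : y \in <[x]>%g -> cycle_char (y ^+ m)%g = cycle_char y ^+ m.
Proof. by move=> /cycleP[i ->]; rewrite -expgM !cycle_char_gen exprM. Qed.

Lemma cycle_char_inj : {in <[x]>%g &, injective cycle_char}.
Proof.
move=> _ _ /cycleP[i ->] /cycleP[j ->]; rewrite !cycle_char_gen => /eqP.
by rewrite (eq_prim_root_expr prim_z) -eq_expg_mod_order => /eqP.
Qed.

Lemma cycle_char_order y : cycle_char y ^+ #[x]%g = 1.
Proof. by rewrite -exprM mulnC exprM (prim_expr_order prim_z) expr1n. Qed.

Lemma cycle_char_onto mu : mu ^+ #[x]%g = 1 -> exists2 y, y \in <[x]>%g & mu = cycle_char y.
Proof.
case/(prim_rootP prim_z)=> i ->; exists (x ^+ i)%g; rewrite ?mem_cycle //.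
by rewrite cycle_char_gen.
Qed.

End CyclicChar.

Lemma intertwine_exp (R : pzRingType) q m (M : 'M[R]_q) (N : 'M[R]_m) X k :
  (M *m X = X *m N -> M ^+ k *m X = X *m N ^+ k)%R.
Proof.
move=> MX; elim: k => [|k IHk]; first by rewrite mul1mx mulmx1.
by rewrite exprSr exprS -!mulmxE -mulmxA MX !mulmxA IHk -!mulmxA mulmxE -exprSr -exprS.
Qed.

Section CyclicSpectrum.

Local Open Scope ring_scope.

Variables (p f m : nat) (F : finFieldType) (pcharF : p \in [pchar F]).
Variables (iota : {rmorphism 'F_p -> F}) (M : 'M['F_p]_m).
Variables (gT : finGroupType) (x : gT) (z : F).
Hypothesis prim_z : #[x]%g.-primitive_root z.
Hypothesis Mx1 : M ^+ #[x]%g = 1%:M.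
Hypothesis regM : forall k (u : 'rV_m), u *m M ^+ k = u -> u != 0 -> (x ^+ k = 1)%g.
Local Notation MF := (map_mx iota M).
Local Notation theta := (cycle_char x z).
Local Notation fr := (frob pcharF).

Definition eig_mult y := \rank (eigenspace MF (theta y)).

Definition spectrum := [set y in <[x]>%g | (0 < eig_mult y)%N].

Lemma expmx_mod_order j k : (x ^+ j = x ^+ k)%g -> M ^+ j = M ^+ k.
Proof.
move=> /eqP; rewrite eq_expg_mod_order => /eqP ejk.
have Mmod i : M ^+ i = M ^+ (i %% #[x]%g).
  by rewrite {1}(divn_eq i #[x]%g) exprD mulnC exprM Mx1 -[1%:M]/(1 : 'M_m) expr1n mul1r.
by rewrite Mmod ejk -Mmod.
Qed.

(** If [y ^+ k = 1], then [M ^+ k] has eigenvalue 1 over [F], hence over the prime field, and [regM]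
    applies. Thus every eigenvalue of [MF] is a primitive root of unity. *)
Lemma spectrum_reg y k : y \in spectrum -> (y ^+ k = 1)%g -> (x ^+ k = 1)%g.
Proof.
rewrite inE lt0n mxrank_eq0 => /andP[xy /eigenvalueP[v vM v0]] yk.
have vMk : v *m map_mx iota (M ^+ k) = v.
  rewrite rmorphXn /= (eigenrows_exp k vM) -(cycle_charX prim_z _ xy) yk.
  by rewrite -(expg0 x) (cycle_char_gen prim_z) scale1r.
have: eigenvalue (map_mx iota (M ^+ k)) 1.
  by apply/eigenvalueP; exists v; rewrite ?scale1r.
rewrite /eigenvalue -(rmorph1 iota) -map_eigenspace map_mx_eq0.
by case/eigenvalueP=> u; rewrite scale1r; apply: regM.
Qed.

(** By [spectrum_reg], [y] generates [<[x]>], so an automorphism fixing [y] fixes [x]. *)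
Lemma spectrum_free (c : {perm gT}) y :
  c \in Aut <[x]>%g -> y \in spectrum -> c y = y -> c = 1%g.
Proof.
move=> Ac sp_y cy; have /andP[xy _] : (y \in <[x]>%g) && (0 < eig_mult y)%N.
  by move: sp_y; rewrite inE.
have gen_y : <[y]>%g = <[x]>%g.
  apply/eqP; rewrite eqEcard cycle_subG xy -!orderE dvdn_leq //.
  by rewrite order_dvdn (spectrum_reg sp_y) ?expg_order.
have x_y : x \in <[y]>%g by rewrite gen_y cycle_id.
have /cycleP[j def_x] := x_y.
have cx : c x = x.
  by rewrite {1}def_x -[c _]/(autm Ac _) morphX ?autmE //= autmE cy -def_x.
apply: (eq_Aut Ac (group1 _)) => _ /cycleP[k ->].
by rewrite -[c _]/(autm Ac _) morphX ?cycle_id //= autmE cx perm1.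
Qed.

(** [X] carries the [theta y]-eigenspace of [M] into that of [M ^+ k], without loss of rank; as
    [M = (M ^+ k) ^+ k'], the image consists of eigenvectors of [M] for [theta y ^+ k']. *)
Lemma mult_intertwine X k k' y :
    X \in unitmx -> M *m X = X *m M ^+ k -> (x ^+ (k * k') = x)%g ->
  y \in <[x]>%g -> (eig_mult y <= eig_mult (y ^+ k')%g)%N.
Proof.
move=> uX MX xkk' xy; set W := eigenspace MF (theta y).
have WM : W *m MF = theta y *: W by apply/eigenspaceP.
have uXF : map_mx iota X \in unitmx by rewrite map_unitmx.
have defM : M = (M ^+ k) ^+ k'.
  by rewrite -exprM -(expr1 M) -exprM; apply: expmx_mod_order; rewrite mul1n expg1.
rewrite /eig_mult -(mxrankMfree W (B := map_mx iota X)) ?row_free_unit //.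
apply/mxrankS/eigenspaceP; rewrite (cycle_charX prim_z) // {1}defM rmorphXn /=.
apply: eigenrows_exp.
by rewrite -mulmxA -map_mxM -MX map_mxM mulmxA WM -scalemxAl.
Qed.

Lemma mult_frob y : y \in <[x]>%g -> eig_mult (y ^+ p)%g = eig_mult y.
Proof.
move=> xy; rewrite /eig_mult (cycle_charX prim_z) //.
have -> : theta y ^+ p = fr 1 (theta y) by rewrite /frob expn1.
rewrite -{1}(map_frob_iota pcharF iota 1 M).
by rewrite -map_eigenspace mxrank_map.
Qed.

Lemma theta_frob (phi : {perm gT}) k y :
    phi \in Aut <[x]>%g -> {in <[x]>%g, forall h, phi h = h ^+ p}%g ->
  y \in <[x]>%g -> theta ((phi ^+ k)%g y) = fr k (theta y).
Proof.
move=> Aphi phiE xy; elim: k => [|k IHk]; first by rewrite perm1 frob0.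
have xky : (phi ^+ k)%g y \in <[x]>%g by rewrite Aut_closed ?groupX.
by rewrite expgSr permM phiE // (cycle_charX prim_z) // IHk /frob -exprM expnSr.
Qed.

(** [K] acts freely on the spectrum, so [free_orbit_transversal] applies, and [theta_frob] turns
    powers of [phi] into powers of Frobenius. Multiplicities are constant on [K]-orbits, so [e]
    depends only on the orbit index. *)
Lemma spectral_basis (K : {group {perm gT}}) (phi : {perm gT}) :
    K \subset Aut <[x]>%g -> phi \in K ->
    {in <[x]>%g, forall h, phi h = h ^+ p}%g -> #[phi]%g = f ->
    {in K & <[x]>%g, forall (c : {perm gT}) y, eig_mult (c y) = eig_mult y} ->
  exists (s : nat) (e : 'I_s -> nat) (lam : 'I_s * 'I_#|K : <[phi]>|%g -> F)
         (B : forall j, 'M[F]_((e j.1).-1.+1, m)),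
    [/\ forall i, (0 < e i)%N, forall j, lam j ^+ #[x]%g = 1,
        forall j, row_free (B j), forall j, (B j == eigenspace MF (lam j))%MS
      & (forall j j' k, (k < f)%N -> fr k (lam j) = lam j' -> (k = 0)%N /\ j = j') /\
        (forall mu, mu ^+ #[x]%g = 1 -> eigenvalue MF mu -> exists j k, mu = fr k (lam j))].
Proof.
move=> sKA Kphi phiE ophi multK.
have spx y : y \in spectrum -> y \in <[x]>%g by rewrite inE => /andP[].
have spK : {in K & spectrum, forall (c : {perm gT}) y, c y \in spectrum}.
  move=> c y Kc sp_y; rewrite inE Aut_closed ?(subsetP sKA) ?spx // multK ?spx //.
  by move: sp_y; rewrite inE => /andP[].
have freeK : {in K & spectrum, forall (c : {perm gT}) y, c y = y -> c = 1%g}.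
  by move=> c y Kc; apply: spectrum_free; apply: (subsetP sKA).
have [s [t [k [spt Kk tonto tinj]]]] := free_orbit_transversal Kphi spK freeK.
have spkt i j : k j (t i) \in spectrum by apply: spK.
pose lam (ij : 'I_s * 'I_#|K : <[phi]>|%g) := theta (k ij.2 (t ij.1)).
pose e i := eig_mult (t i).
have e_gt0 i : (0 < e i)%N by have := spt i; rewrite inE => /andP[].
have /fin_all_exists[B BP] (ij : 'I_s * 'I_#|K : <[phi]>|%g) :
    exists B : 'M[F]_((e ij.1).-1.+1, m), row_free B /\ (B == eigenspace MF (lam ij))%MS.
  have rE : \rank (eigenspace MF (lam ij)) = (e ij.1).-1.+1.
    by rewrite prednK // -[LHS]/(eig_mult _) multK ?spx.
  (* Rewriting the dimension as the rank gives the matrix type of [row_base]. *)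
  rewrite -rE; exists (row_base (eigenspace MF (lam ij))).
  by rewrite row_base_free; split=> //; apply/eqmxP/eq_row_base.
have Aphi := subsetP sKA _ Kphi.
exists s, e, lam, B; split=> [//|ij|ij|ij|]; try by case: (BP ij).
  exact: (cycle_char_order prim_z).
split=> [[i j] [i' j'] q ltq | mu mun].
  rewrite /lam /= -(theta_frob q Aphi phiE) ?spx // => /(cycle_char_inj prim_z).
  rewrite Aut_closed ?groupX ?spx // => /(_ isT isT) /tinj.
  by rewrite ophi => /(_ ltq) [-> -> ->].
have [y xy ->] := cycle_char_onto prim_z mun => eig_y.
have /tonto[i [j [q ->]]] : y \in spectrum by rewrite inE xy lt0n mxrank_eq0.
by exists (i, j), q; rewrite (theta_frob q Aphi phiE) ?spx.
Qed.

End CyclicSpectrum.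

(** * The centralizer of the complement *)

Section CentralizerGL.

Local Open Scope ring_scope.

Variables (p f n m s l : nat) (F : finFieldType) (pcharF : p \in [pchar F]).
Variables (iota : {rmorphism 'F_p -> F}) (z : F) (M : 'M['F_p]_m).
Hypotheses (cardF : #|F| = (p ^ f)%N) (prim_z : n.-primitive_root z).
Hypothesis Mn1 : M ^+ n = 1%:M.
Local Notation MF := (map_mx iota M).
Local Notation "A ^i" := (map_mx iota A) (at level 2).
Local Notation fr := (frob pcharF).
Local Notation J := ('I_s * 'I_l)%type.
Variables (e : 'I_s -> nat) (lam : J -> F).
(* (e i).-1.+1 is the size of the matrices in {'GL_(e i)[F]}. *)
Variable B : forall j : J, 'M[F]_((e j.1).-1.+1, m).
Hypothesis lam_n : forall j, lam j ^+ n = 1.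
Hypothesis freeB : forall j, row_free (B j).
Hypothesis eqB : forall j, (B j == eigenspace MF (lam j))%MS.
Hypothesis lam_inj :
  forall j j' k, (k < f)%N -> fr k (lam j) = lam j' -> (k = 0)%N /\ j = j'.
Hypothesis lam_onto : forall mu, mu ^+ n = 1 -> eigenvalue MF mu ->
  exists j k, mu = fr k (lam j).

Let dex q C := @descent_ex p f n m F pcharF iota z M cardF prim_z J lam _ B
  lam_n freeB eqB lam_inj q C.
Let duniq q X X' := @descent_uniq p n m F pcharF iota z M prim_z Mn1 J lam _ B
  eqB lam_onto q X X'.

Let BM j : B j *m MF = lam j *: B j.
Proof. by have /andP[/eigenspaceP] := eqB j. Qed.

(** Descent gives [X] sending each [B j] to its Frobenius conjugate, whose eigenvalue is
    [lam j ^+ p]; so [X] conjugates [M] and [M ^+ p]. This realizes the power automorphism of [H] on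
    [V]. *)
Lemma frob_intertwiner :
  exists2 X, X \in unitmx & M *m X = X *m M ^+ p.
Proof.
have [X BX] := dex (fun j => map_mx (fr 1) (B j)).
(* The exponent [f.-1] makes [Z] the inverse of [X], since Frobenius has period [f]. *)
have [Z BZ] := dex (fun j => map_mx (fr f.-1) (B j)).
have f_gt0 : (0 < f)%N by case: f cardF (card_finNzRing_gt1 F) => // ->.
have XZ1 : X *m Z = 1%:M.
  apply: duniq => j; rewrite map_mxM mulmxA BX -(map_frob_iota pcharF iota 1 Z).
  rewrite -map_mxM BZ -map_frobD add1n (prednK f_gt0) map_mx1 mulmx1.
  by apply/matrixP=> a b; rewrite !mxE frob_period.
have [uX uZ] := mulmx1_unit XZ1.
have XM : X *m M = M ^+ p *m X.
  apply: duniq => j; rewrite !map_mxM rmorphXn /= !mulmxA (eigenrows_exp p (BM j)).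
  by rewrite -scalemxAl BX (eigenrowsM pcharF eqB) /frob expn1.
exists Z => //.
by rewrite -[LHS]mul1mx -(mulmx1C XZ1) -mulmxA (mulmxA X) XM -mulmxA XZ1 mulmx1.
Qed.

(** For [X] commuting with [M], the matrix of [X] on the [lam j]-eigenspace in the basis of rows of
    [B j]. *)
Definition coordmx (X : 'M['F_p]_m) (j : J) : 'M[F]_((e j.1).-1.+1) :=
  B j *m X^i *m pinvmx (B j).

Lemma coordmxK X j : X *m M = M *m X -> coordmx X j *m B j = B j *m X^i.
Proof.
move=> XM; apply: mulmxKpV; have /andP[_] := eqB j; apply: submx_trans.
by apply/eigenspaceP; rewrite -mulmxA -map_mxM XM map_mxM mulmxA BM scalemxAl.
Qed.

Lemma coordmxM X X' j : X *m M = M *m X ->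
  coordmx (X *m X') j = coordmx X j *m coordmx X' j.
Proof.
by move=> XM; rewrite {3}/coordmx !mulmxA (coordmxK j XM) /coordmx map_mxM !mulmxA.
Qed.

Lemma coordmx1 j : coordmx 1%:M j = 1%:M.
Proof. by rewrite /coordmx map_mx1 mulmx1 mulmxVp. Qed.

Lemma coordmx_inj X X' : X *m M = M *m X -> X' *m M = M *m X' ->
  (forall j, coordmx X j = coordmx X' j) -> X = X'.
Proof.
by move=> XM XM' eqXX'; apply: duniq => j; rewrite -!coordmxK ?eqXX'.
Qed.

(** Descent provides both [X] and its candidate inverse [Z]; uniqueness of descent yields
    [X *m Z = 1%:M] and the commutation with [M]. *)
Lemma coordmx_onto (Y : forall j : J, 'M[F]_((e j.1).-1.+1)) :
    (forall j, Y j \in unitmx) ->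
  exists X, [/\ X \in unitmx, X *m M = M *m X & forall j, coordmx X j = Y j].
Proof.
move=> uY.
have [X BX] := dex (fun j => Y j *m B j).
have [Z BZ] := dex (fun j => invmx (Y j) *m B j).
exists X; split=> [||j]; last by rewrite /coordmx BX -mulmxA mulmxVp ?mulmx1.
  suffices /mulmx1_unit[] : X *m Z = 1%:M by [].
  apply: duniq => j; rewrite map_mxM mulmxA BX -mulmxA BZ mulmxA mulmxV //.
  by rewrite map_mx1 mul1mx mulmx1.
apply: duniq => j; rewrite !map_mxM !mulmxA BX BM -mulmxA BM.
by rewrite -scalemxAl -scalemxAr BX.
Qed.

Variables (cT : finGroupType) (C : {group cT}) (rC : mx_representation 'F_p C m).
Hypothesis injC : {in C &, injective rC}.
Hypothesis commC : {in C, forall c, rC c *m M = M *m rC c}.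
Hypothesis ontoC :
  forall X, X \in unitmx -> X *m M = M *m X -> exists2 c, c \in C & rC c = X.

(** The default [1] of [insubd] is never taken on [C], where the coordinate matrices are invertible,
    by [GLcoordE]. *)
Definition GLcoord (c : cT) : GLprod F l e :=
  finfun (fun i : 'I_s => finfun (fun j : 'I_l =>
    insubd (1%g : {'GL_(e i)[F]}) (coordmx (rC c) (i, j)))).

Lemma GLcoordE c i j : c \in C ->
  val (GLcoord c i j) = coordmx (rC c) (i, j).
Proof.
move=> Cc; rewrite !ffunE val_insubd ifT //.
have : coordmx (rC c) (i, j) *m coordmx (rC c^-1%g) (i, j) = 1%:M.
  rewrite -coordmxM ?commC // -repr_mxM ?groupV // mulgV repr_mx1.
  exact: coordmx1.
by case/mulmx1_unit.
Qed.

Lemma GLcoordM : {in C &, {morph GLcoord : c d / (c * d)%g}}.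
Proof.
move=> c d Cc Cd; apply/ffunP=> i; rewrite [RHS]ffunE; apply/ffunP=> j.
rewrite [RHS]ffunE; apply: val_inj.
rewrite [RHS]/= !GLcoordE ?groupM // repr_mxM // coordmxM ?commC //.
Qed.

Lemma GLprod_isog : C \isog [set: GLprod F l e].
Proof.
apply/isogP; exists (Morphism GLcoordM).
  apply/injmP=> c d Cc Cd /= eq_cd; apply: injC => //.
  apply: coordmx_inj => [||[i j]]; rewrite ?commC //.
  by rewrite -!GLcoordE // eq_cd.
apply/setP=> Y; rewrite [RHS]inE; apply/morphimP.
have [|X [uX XM cX]] := @coordmx_onto (fun j => val (Y j.1 j.2)).
  by move=> j; apply: valP.
have [c Cc rc] := ontoC uX XM; exists c => //=.
apply/ffunP=> i; apply/ffunP=> j; apply: val_inj.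
by rewrite GLcoordE // rc cX.
Qed.

End CentralizerGL.

(** * The action of the stabilizer on a cyclic complement *)

Lemma finField_prim_root (F : finFieldType) n :
  (0 < n)%N -> n %| #|F|.-1 -> exists z : F, n.-primitive_root%R z.
Proof.
move=> n_gt0 n_dv.
have F_gt0 : (0 < #|F|.-1)%N.
  by rewrite -ltnS prednK ?card_finNzRing_gt1 // ltnW ?card_finNzRing_gt1.
pose rs := enum (predC1 (0%R : F)).
have sz_rs : size rs = #|F|.-1 by rewrite -cardE cardC1.
have rs1 : all (#|F|.-1).-unity_root%R rs.
  apply/allP=> y; rewrite mem_enum => y0; apply/unity_rootP.
  by apply: (mulfI y0); rewrite -exprS prednK ?expf_card ?mulr1 // ltnW ?card_finNzRing_gt1.
have /hasP[z _ zprim] : has (#|F|.-1).-primitive_root%R rs.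
  by apply: has_prim_root; rewrite ?enum_uniq ?sz_rs.
by exists (z ^+ (#|F|.-1 %/ n))%R; apply: dvdn_prim_root.
Qed.

Lemma power_aut_exists (gT : finGroupType) (x : gT) p :
  coprime #[x] p -> exists phi, is_power_aut <[x]> p phi.
Proof.
move=> co_x_p.
have injf : 'injm (cyclem p x).
  apply/subsetP=> h /morphpreP[Hh /set1P hp1]; apply/set1P/eqP.
  have dv_p : #[h] %| p by rewrite order_dvdn; apply/eqP.
  rewrite -order_eq1 -dvdn1 -(eqP co_x_p) dvdn_gcd dv_p andbT.
  exact: order_dvdG.
have imf : cyclem p x @* <[x]> = <[x]>.
  apply/eqP; rewrite eqEcard card_injm // leqnn andbT.
  by apply/subsetP=> _ /morphimP[h _ Hh ->]; apply: groupX.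
exists (aut injf imf); split; first exact: Aut_aut.
by move=> h Hh; rewrite autE.
Qed.

Lemma power_autX (gT : finGroupType) (H : {group gT}) p phi k h :
  is_power_aut H p phi -> h \in H -> (phi ^+ k) h = h ^+ (p ^ k).
Proof.
case=> Aphi phiE Hh; elim: k => [|k IHk]; first by rewrite perm1 expg1.
by rewrite expgSr permM IHk phiE ?groupX // -expgM expnSr.
Qed.

(** [phi ^+ k] is trivial exactly when it fixes [x], that is, when [#[x]] divides [p ^ k - 1]. *)
Lemma order_power_aut (gT : finGroupType) (x : gT) p f phi :
    prime p -> is_power_aut <[x]> p phi -> is_ord #[x] p f -> #[phi] = f.
Proof.
move=> p_pr phiP [f_gt0 dv_f min_f].
have phi1 k : (phi ^+ k == 1) = (#[x] %| p ^ k - 1).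
  have pk_gt0 : (0 < p ^ k)%N by rewrite expn_gt0 prime_gt0.
  apply/eqP/idP=> [phik1 | dv_k].
    rewrite order_dvdn -(can_eq (mulgK x)) -expgSr subn1 prednK // mul1g.
    by rewrite -(power_autX _ phiP) ?cycle_id // phik1 perm1.
  have [Aphi _] := phiP.
  apply: (eq_Aut (groupX k Aphi) (group1 _)) => h Hh; rewrite perm1.
  rewrite (power_autX _ phiP Hh) -(prednK pk_gt0) expgS -subn1.
  suffices /eqP-> : h ^+ (p ^ k - 1) == 1 by rewrite mulg1.
  by rewrite -order_dvdn (dvdn_trans _ dv_k) // order_dvdG.
apply/eqP; rewrite eqn_leq dvdn_leq //=; last by rewrite order_dvdn phi1.
by apply: min_f; rewrite ?order_gt0 // -phi1 expg_order.
Qed.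

Section CyclicComplement.

Variables (p : nat) (gT : finGroupType) (G V : {group gT}) (x : gT).
Local Notation H := (cycle_group x).
Hypothesis frobG : [Frobenius G = V ><| H].
Local Notation E := (inner_image G V).
Hypothesis abelE : p.-abelem E.
Hypothesis ntE : E :!=: 1.
Local Notation rA := (Aut_repr frobG abelE ntE).
Local Notation cG := (conj_aut G).
Local Notation A := (Aut G :&: 'N(H | 'P))%G.
Local Notation K := (restr_perm H @* A)%G.

Let sHG : H \subset G.
Proof. by have [defG] := Frobenius_context frobG; have [] := sdprod_context defG. Qed.

Let HG h : h \in H -> h \in G.
Proof. exact: (subsetP sHG). Qed.

Definition gen_mx : 'M['F_p]_('dim E) := rA (cG x).
Local Notation M := gen_mx.

Let sAN : A \subset 'N(H | 'P).
Proof. exact: subsetIr. Qed.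

Let cX k : cG (x ^+ k) = cG x ^+ k.
Proof. by rewrite morphX // (subsetP (normG G)) // HG ?cycle_id. Qed.

Let cA g : cG g \in Aut G. Proof. by apply: Aut_aut. Qed.

Lemma gen_mxX k : rA (cG (x ^+ k)) = (M ^+ k)%R.
Proof. by rewrite cX repr_mxX. Qed.

Lemma gen_mx_order : (M ^+ #[x] = 1%:M)%R.
Proof. by rewrite -gen_mxX expg_order morph1 repr_mx1. Qed.

Lemma gen_mx_fixed k (u : 'rV_('dim E)) :
  (u *m M ^+ k = u)%R -> u != 0%R -> x ^+ k = 1.
Proof. by rewrite -gen_mxX; apply: Aut_repr_fixed; apply: mem_cycle. Qed.

Lemma compl_aut_sub : K \subset Aut H.
Proof. by apply: subset_trans (morphimS _ (subsetIl _ _)) _; apply: restr_perm_Aut. Qed.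

Lemma mem_compl_aut (a c : {perm gT}) :
  a \in Aut G -> c \in Aut H -> {in H, a =1 c} -> c \in K.
Proof.
move=> Aa Ac aE.
have Na : a \in 'N(H | 'P).
  by apply/astabs_permP=> h Hh; rewrite aE // Aut_closed.
have Ka : restr_perm H a \in K.
  by apply: mem_morphim => //; apply/setIP.
suffices <- : restr_perm H a = c by [].
apply: (eq_Aut (subsetP compl_aut_sub _ Ka) Ac) => h Hh.
by rewrite restr_permE // aE.
Qed.

Lemma compl_aut_lift (c : {perm gT}) : c \in K ->
  exists a : {perm gT}, [/\ a \in Aut G, {in H, a =1 c} & {in H, forall h, a h \in H}].
Proof.
case/morphimP=> a Na /setIP[Aa _] ->; exists a; split=> // h Hh.
  by rewrite restr_permE.
by have /astabs_permP := Na; apply.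
Qed.

Section Multiplicities.

Variables (F : finFieldType) (f : nat) (z : F) (iota : {rmorphism 'F_p -> F}).
Hypothesis prim_z : #[x].-primitive_root%R z.
Local Notation mu := (eig_mult iota M x z).

Lemma compl_aut_mult : {in K & H, forall (c : {perm gT}) y, mu (c y) = mu y}.
Proof.
(* One inequality for all [c] suffices: applied to [c^-1] it gives the other. The matrix used comes
   from a lift of [c^-1], so that [k] belongs to [c^-1] and [k'] to [c]. *)
have le_mu c y : c \in K -> y \in H -> (mu y <= mu (c y))%N.
  move=> Kc Hy; have [a [Aa aE aH]] := compl_aut_lift (groupVr Kc).
  have Ac : c \in Aut H := subsetP compl_aut_sub c Kc.
  have /cycleP[k ax] : a x \in <[x]> by apply: aH; apply: cycle_id.
  have /cycleP[k' cx] : c x \in <[x]> by rewrite Aut_closed ?cycle_id.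
  have cy : c y = y ^+ k'.
    have /cycleP[i ->] := Hy.
    rewrite -[LHS]/(autm Ac _) morphX ?cycle_id //= autmE cx.
    by rewrite -!expgM mulnC.
  rewrite cy; apply: (mult_intertwine iota prim_z gen_mx_order (X := rA a) (k := k)) => //.
  - exact: repr_mx_unit.
  - by rewrite -gen_mxX -ax; apply: Aut_reprJ; rewrite ?HG ?cycle_id.
  rewrite expgM -ax aE ?cycle_id //.
  have Acv : c^-1 \in Aut H by rewrite groupV.
  have Hcx : c^-1 x \in H by rewrite Aut_closed ?cycle_id.
  have -> : (c^-1 x) ^+ k' = c^-1 (x ^+ k').
    by rewrite -[c^-1 (x ^+ k')]/(autm Acv _) morphX ?cycle_id //= autmE.
  by rewrite -cx permK.
move=> c y Kc Hy.
have Hcy : c y \in H by rewrite Aut_closed // (subsetP compl_aut_sub).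
apply: anti_leq; rewrite (le_mu c y Kc Hy) andbT.
by rewrite -{2}(permK c y) (le_mu c^-1 (c y) (groupVr Kc) Hcy).
Qed.

Hypotheses (pcharF : p \in [pchar F]%R) (cardF : #|F| = (p ^ f)%N).

Lemma power_aut_compl phi : is_power_aut H p phi -> #[phi] = f -> phi \in K.
Proof.
case=> Aphi phiE ophi.
have sphiA : <[phi]> \subset Aut H by rewrite cycle_subG.
have mu_phi : {in <[phi]> & H, forall (c : {perm gT}) y, mu (c y) = mu y}.
  move=> _ y /cycleP[k ->] Hy; elim: k => [|k IHk]; first by rewrite perm1.
  have Hky : (phi ^+ k) y \in H by rewrite Aut_closed // groupX.
  by rewrite expgSr permM phiE // (mult_frob pcharF).
(* The basis is built for [<[phi]>] in place of [K], because membership of [phi] in [K] is still to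
   be proved. *)
have [s [e [lam [B [_ lam_n freeB eqB [lam_inj lam_onto]]]]]] :=
  spectral_basis pcharF prim_z gen_mx_fixed
    sphiA (cycle_id phi) phiE ophi mu_phi.
have [X uX MX] := frob_intertwiner cardF prim_z gen_mx_order lam_n freeB eqB lam_inj lam_onto.
have XJ : {in H, forall h, rA (cG h) *m X = X *m rA (cG (phi h))}%R.
  move=> _ /cycleP[k ->]; rewrite phiE ?mem_cycle // -expgM mulnC !gen_mxX exprM.
  exact: intertwine_exp.
have [a [Aa _ aE]] := Aut_of_mx uX Aphi XJ.
exact: mem_compl_aut Aa Aphi aE.
Qed.

End Multiplicities.

End CyclicComplement.

(** * The pointwise fixator of [H] in [Aut G] as the centralizer of [M] *)

Section Fixator.

Variables (p : nat) (gT : finGroupType) (G V : {group gT}) (x : gT).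
Local Notation H := (cycle_group x).
Hypothesis frobG : [Frobenius G = V ><| H].
Local Notation E := (inner_image G V).
Hypothesis abelE : p.-abelem E.
Hypothesis ntE : E :!=: 1.
Local Notation rA := (Aut_repr frobG abelE ntE).
Local Notation M := (gen_mx frobG abelE ntE).
Local Notation A := (Aut G :&: 'N(H | 'P))%G.

Definition fixator := ('ker_A (restr_perm H))%G.
Local Notation C := fixator.

Let HG h : h \in H -> h \in G.
Proof.
have [defG _ _ _ _] := Frobenius_context frobG.
by have [_ sHG _ _ _] := sdprod_context defG; apply: (subsetP sHG).
Qed.

Lemma fixator_normal : C <| A.
Proof.
have sAN : A \subset 'N(H | 'P) by apply: subsetIr.
by have := ker_normal (restrm_morphism sAN (restr_perm_morphism H)); rewrite ker_restrm.
Qed.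

Lemma fixatorP (c : {perm gT}) : reflect (c \in Aut G /\ {in H, forall h, c h = h}) (c \in C).
Proof.
have -> : (c \in C) = (c \in A :&: 'C(H | 'P)) by rewrite /= ker_restr_perm.
apply: (iffP setIP) => [[/setIP[Ac _] /astabP cH] | [Ac cH]].
  by split=> // h Hh; apply: cH.
split; last by apply/astabP.
by rewrite inE Ac; apply/astabs_permP=> h Hh; rewrite cH.
Qed.

Lemma fixator_sub : C \subset Aut G.
Proof. by apply/subsetP=> c /fixatorP[]. Qed.

Definition fixator_repr := subg_repr rA fixator_sub.
Local Notation rC := fixator_repr.

Lemma fixator_repr_inj : {in C &, injective rC}.
Proof.
move=> c d /fixatorP[Ac cH] /fixatorP[Ad dH] eq_r.
by apply: (Aut_repr_inj Ac Ad eq_r) => h Hh; rewrite cH ?dH.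
Qed.

Lemma fixator_repr_comm : {in C, forall c, rC c *m M = M *m rC c}%R.
Proof.
move=> c /fixatorP[Ac cH]; apply/esym.
have Hx : x \in H by apply: cycle_id.
by have := Aut_reprJ frobG abelE ntE Ac (HG Hx); rewrite cH.
Qed.

(** This is [Aut_of_mx] with the trivial automorphism on [H]. *)
Lemma fixator_repr_onto X : X \in unitmx -> (X *m M = M *m X)%R ->
  exists2 c, c \in C & rC c = X.
Proof.
move=> uX XM.
have XJ : {in H, forall h,
    rA (conj_aut G h) *m X = X *m rA (conj_aut G ((1 : {perm gT}) h))}%R.
  move=> _ /cycleP[k ->]; rewrite perm1 gen_mxX; exact: intertwine_exp.
have [a [Aa ra aH]] := Aut_of_mx uX (group1 _) XJ.
exists a => //; apply/fixatorP; split=> // h Hh.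
by rewrite aH ?perm1.
Qed.

End Fixator.

(* F is the field with p ^ f elements, which exists by pPrimePowerField. *)
Theorem theorem1p1 (p d n f : nat) (gT : finGroupType) (G V H : {group gT})
    (F : finFieldType)
    (p_prime : prime p) (d_gt0 : (0 < d)%N) (n_gt0 : (0 < n)%N)
    (frobG : [Frobenius G = V ><| H])
    (abelemV : p.-abelem V) (cardV : #|V| = (p ^ d)%N)
    (cycH : cyclic H) (cardH : #|H| = n)
    (ordf : is_ord n p f) (cardF : #|F| = (p ^ f)%N) :
  exists (s l : nat) (e : 'I_s -> nat) (lT : finGroupType) (L : {group lT}),
    [/\ (0 < s)%N, (0 < l)%N, forall i, (0 < e i)%N,
        ((\sum_(i < s) e i) * f * l)%N = d & #|L| = l] /\
    inner_image G V <| Aut G /\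
    exists P : {group coset_of (inner_image G V)},
      [/\ P <| Aut G / inner_image G V, P \isog [set: GLprod F l e] &
        exists (K : {group {perm gT}}) (phi : {perm gT}),
          [/\ K \subset Aut H, (Aut G / inner_image G V) / P \isog K,
              is_power_aut H p phi, #[phi] = f &
              <[phi]> <| K /\ K / <[phi]> \isog L]].
Proof.
have [x defH] := cyclicP cycH; have eqH : H = <[x]>%G by apply/group_inj.
subst H; clear cycH defH; subst n.
have [f_gt0 dv_f _] := ordf.
have pcharF : p \in [pchar F]%R by apply: card_finPcharP cardF p_prime.
have isoE := inner_image_isog frobG.
have abelE : p.-abelem (inner_image G V) by rewrite -(isog_abelem isoE).
have [_ ntV _ _ _] := Frobenius_context frobG.
have ntE : (inner_image G V : {set _}) != 1 by rewrite -(isog_eq1 isoE).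
(* [#[x]] divides [p ^ f - 1], which is prime to [p] because [f > 0]. *)
have co_x_p : coprime #[x] p.
  rewrite coprime_sym -(@coprime_pexpl f) //.
  apply: coprime_dvdr dv_f _; rewrite subn1 coprime_sym.
  by rewrite coprimePn ?expn_gt0 ?prime_gt0.
have [phi phiP] := power_aut_exists co_x_p.
have ophi : #[phi] = f := order_power_aut p_prime phiP ordf.
have [|z prim_z] := @finField_prim_root F #[x] (order_gt0 x).
  by rewrite cardF -subn1.
(* [pPrimeCharType pcharF] is [F] viewed as an algebra over its prime field. *)
pose iota : {rmorphism 'F_p -> F} :=
  (GRing.in_alg (pPrimeCharType pcharF) : {rmorphism 'F_p -> pPrimeCharType pcharF}).
set A := (Aut G :&: 'N(cycle_group x | 'P))%G.
set K := (restr_perm (cycle_group x) @* A)%G.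
have Kphi : phi \in K.
  exact: (power_aut_compl frobG abelE ntE iota prim_z pcharF cardF phiP ophi).
have sKA : K \subset Aut <[x]> := compl_aut_sub frobG.
have [Aphi phiE] := phiP.
have [s [e [lam [B [e_gt0 lam_n freeB eqB [lam_inj lam_onto]]]]]] :=
  spectral_basis pcharF prim_z (gen_mx_fixed (ntE := ntE)) sKA Kphi phiE ophi
    (compl_aut_mult frobG abelE ntE iota prim_z).
(* Normality is automatic, as the automorphism group of a cyclic group is abelian. *)
have nphiK : <[phi]> <| K.
  rewrite -sub_abelian_normal ?cycle_subG //.
  exact: abelianS sKA (Aut_cyclic_abelian (cycle_cyclic x)).
set l := #|K : <[phi]>| in lam B freeB eqB lam_n lam_inj lam_onto.
(* The index set consists of pairs, so [descent_card] counts each [e i] exactly [l] times. *)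
have dim_d : d = (f * (l * \sum_(i < s) e i))%N.
  have := descent_card cardF prim_z (gen_mx_order frobG abelE ntE)
    lam_n freeB eqB lam_inj lam_onto.
  rewrite (dim_abelemE abelE ntE) -(card_isog isoE) cardV pfactorK // => ->.
  congr (_ * _)%N; rewrite -(pair_bigA _ (fun i _ => (e i).-1.+1)) big_distrr /=.
  by apply: eq_bigr => i _; rewrite sum_nat_const card_ord prednK.
have [nsP isoP isoK] := quotient_compl (inner_image_normal frobG)
  (inner_image_mul frobG (abelian_sol (abelem_abelian abelemV))) (inner_image_TI frobG)
  (fixator_normal G x).
(* [L] is [K / <[phi]>], of order the index [l]. *)
exists s, l, e, (coset_of <[phi]>), (K / <[phi]>)%G; split.
  split=> //; last 2 first.
  - by rewrite dim_d [(l * _)%N]mulnC mulnA [(f * _)%N]mulnC.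
  - by rewrite card_quotient ?normal_norm.
  - rewrite lt0n; apply: contraTneq d_gt0 => s0; rewrite dim_d big1 ?muln0 // => i _.
    by have := leq_trans (ltn_ord i) (eq_leq s0).
  exact: indexg_gt0.
split; first exact: inner_image_normal frobG.
exists (fixator G x / inner_image G V)%G; split=> //.
  rewrite -(isog_transl _ isoP).
  exact: (GLprod_isog cardF prim_z (gen_mx_order frobG abelE ntE) lam_n freeB eqB
    lam_inj lam_onto (@fixator_repr_inj _ _ _ _ _ frobG abelE ntE)
    (@fixator_repr_comm _ _ _ _ _ frobG abelE ntE)
    (@fixator_repr_onto _ _ _ _ _ frobG abelE ntE)).
exists K, phi; split=> //; last by split; rewrite ?isog_refl.
(* [K] is the image of [A] under restriction to [H], with kernel the fixator. *)
by apply: isog_trans isoK _; apply: first_isog_loc; apply: subsetIr.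
Qed.
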